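(* Let $p$ be an odd prime and let $(s_u)_{u\ge 0}$ be the $2p$-periodic quaternary sequence over $\mathbb{Z}_4$ defined by $$ s_u=\begin{cases} 0, & \text{if } u \bmod 2p=0 \text{ or } u \bmod 2p\in D_0,\\ 1, & \text{if } u \bmod 2p\in D_1,\\ 2, & \text{if } u \bmod 2p=p \text{ or } u \bmod 2p\in E_0,\\ 3, & \text{if } u \bmod 2p\in E_1. \end{cases} $$ Then the linear complexity of $(s_u)_{u\ge 0}$ over $\mathbb{Z}_4$ satisfies $$ LC((s_u)_{u\ge 0})=\begin{cases} p, & \text{if } p\equiv -1 \pmod{16},\\ p+1, & \text{if } p\equiv 1 \pmod{16}. \end{cases} $$
   Context: Let $p$ be an odd prime and let $g$ be an odd integer that is a primitive root both modulo $p$ and modulo $2p$. Write $\mathbb{Z}_{2p}=\{0,1,\ldots,2p-1\}$ for the residue class ring modulo $2p$ and put $$D_0=\{g^{2n} \bmod 2p : 0\le n\le (p-3)/2\},\qquad D_1=\{g^{2n+1} \bmod 2p : 0\le n\le (p-3)/2\},$$ and $E_i=\{2u \bmod 2p : u\in D_i\}$ for $i=0,1$. Then $\mathbb{Z}_{2p}$ is the disjoint union $D_0\cup D_1\cup E_0\cup E_1\cup\{0,p\}$. $\mathbb{Z}_4=\{0,1,2,3\}$ is the residue class ring modulo $4$. The linear complexity $LC((s_u)_{u\ge0})$ of a sequence over $\mathbb{Z}_4$ is the least $L$ for which there exist $c_1,\ldots,c_L\in\mathbb{Z}_4$ with $s_{u+L}+c_1s_{u+L-1}+\cdots+c_{L-1}s_{u+1}+c_Ls_u=0$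 for all $u\ge 0$. *)

(* Defs.v *)
From mathcomp Require Import all_boot all_order all_algebra.

Set Implicit Arguments.
Unset Strict Implicit.
Unset Printing Implicit Defensive.

Import GRing.Theory.
Local Open Scope ring_scope.

(* The class of [g] in ['Z_n] has multiplicative order [totient n].
   Only meaningful for [n > 1], since ['Z_0] and ['Z_1] are ['Z_2]. *)
Definition primitive_root_mod (n : nat) (g : int) : bool :=
  (totient n).-primitive_root (g%:~R : 'Z_n).

Section Classes.
Variables (p : nat) (g : int).

(* [n] ranges over 0 <= n <= (p - 3) / 2. *)
Definition classD (i : nat) : {set 'Z_(2 * p)} :=
  [set (g%:~R : 'Z_(2 * p)) ^+ (2 * n + i) | n : 'I_((p - 3) %/ 2).+1].

Definition classE (i : nat) : {set 'Z_(2 * p)} :=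
  [set 2%:R * u | u in classD i].

(* When [p] is an odd prime and [g] is an odd primitive root modulo [p] and
   [2 * p], the cases are disjoint and exhaustive, so neither their order nor
   the final default value matters. *)
Definition quaternary_seq (u : nat) : 'Z_4 :=
  let x : 'Z_(2 * p) := u%:R in
  if (x == 0) || (x \in classD 0) then 0
  else if x \in classD 1 then 1
  else if (x == p%:R) || (x \in classE 0) then 2%:R
  else if x \in classE 1 then 3%:R
  else 0.

End Classes.

(* Only the values [c 1], ..., [c L] are used. *)
Definition has_recurrence (s : nat -> 'Z_4) (L : nat) : Prop :=
  exists c : nat -> 'Z_4, forall u : nat,
    s (u + L)%N + \sum_(1 <= j < L.+1) c j * s (u + L - j)%N = 0.

Definition is_linear_complexity (s : nat -> 'Z_4) (L : nat) : Prop :=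
  has_recurrence s L /\ forall L' : nat, has_recurrence s L' -> (L <= L')%N.

(* Main.v *)
Require Import Defs.
From mathcomp Require Import all_boot all_order all_algebra all_field.
From mathcomp Require Import ring zify.

(** Let [E] be the shift, [e] the indicator of the even integers, [d] that of
    the multiples of [p] and [n] that of the quadratic nonresidues modulo [p].
    When [p = +-1 %[mod 16]], the sequence is [s = 2 e + 2 d + n] over Z/4.
    The Jacobi sums of the quadratic character show that [n * n = - n] modulo 4 for cyclic convolution; the same count,
    whose parity is decided by the fixed point [u / 2] of [b |-> u - b], shows
    that 2 is a residue, which is what puts [s] in this form.

    Upper bounds: [(E + 1) (E^(p-1) + ... + 1)] kills [s] if
    [p = -1 %[mod 16]], and [(E^p - 1) (E - 1)] always does.

    Lower bounds: let [M] be the sum of the [E^a], where [a] runs over even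
    representatives of the opposites of the nonresidues.  Then [(M - 1) s] is
    [2 d] if [p = -1 %[mod 16]], and [2 (e + d)] if [p = 1 %[mod 16]].  A
    monic [f] killing [s] kills this too.  In the first case no [f] of degree
    less than [p] does.  In the second case, for [f] of degree [p], [f(E) (2 d)]
    has periods 2 and [p], so it is constant, hence so is [2 f_j] for
    [0 < j < p], and then [f(E) (2 (e + d))] is not zero at 0. *)

Set Implicit Arguments.
Unset Strict Implicit.
Unset Printing Implicit Defensive.

Import Order.TTheory GRing.Theory Num.Theory.
Local Open Scope ring_scope.

(** * Quadratic residues in a finite field of odd order *)

Section Nonresidues.
Variable F : finFieldType.
Hypothesis two_neq0 : (2%:R : F) != 0.
Implicit Types x y u : F.

(* For [x != 0], exactly one of [x] and [- x] has the smaller rank. *)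
Lemma odd_sum_even_fun (f : F -> nat) :
  (forall x, f (- x) = f x) -> odd (\sum_x f x) = odd (f 0).
Proof.
move=> fN; rewrite (bigD1 0) //= oddD.
rewrite (bigID (fun x => enum_rank x < enum_rank (- x))%N) /=.
rewrite [X in (_ + X)%N](reindex_inj (@oppr_inj F)) /=.
under [X in (_ + X)%N]eq_bigr do rewrite fN.
rewrite [X in (_ + X)%N](eq_bigl
  (fun x => (x != 0) && (enum_rank x < enum_rank (- x))%N)).
  by rewrite addnn odd_double addbF.
move=> x /=; rewrite opprK oppr_eq0 -leqNgt leq_eqVlt.
have [//|x0 /=] := eqVneq x 0.
suff /negPf -> : val (enum_rank x) != val (enum_rank (- x)) by [].
apply: contra x0 => /eqP /val_inj /enum_rank_inj /eqP.
by rewrite -subr_eq0 opprK -mulr2n -mulr_natl mulf_eq0 (negPf two_neq0).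
Qed.

Lemma odd_card_finField : odd #|F|.
Proof. by rewrite -sum1_card (@odd_sum_even_fun (fun=> 1)). Qed.

Lemma half_card : #|F| = (#|F|./2).*2.+1.
Proof. by rewrite -[LHS]odd_double_half odd_card_finField. Qed.

(** Euler's criterion serves as the definition, so that multiplicativity follows from that of
    powers. *)
Definition nonres x : bool := (x != 0) && (x ^+ #|F|./2 != 1).

Definition quad_char x : int := if x == 0 then 0 else (-1) ^+ nonres x.

Lemma nonres0 : nonres 0 = false.
Proof. by rewrite /nonres eqxx. Qed.

Lemma euler_criterion x : x != 0 -> x ^+ #|F|./2 = (-1) ^+ nonres x.
Proof.
move=> x0; rewrite /nonres x0 /=; case: eqP => [-> //| /eqP x1].
have /eqP : (x ^+ #|F|./2) ^+ 2 = 1.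
  apply: (mulfI x0); rewrite mulr1 -exprM muln2 -exprS -half_card.
  exact: expf_card.
by rewrite sqrf_eq1 (negPf x1) => /eqP.
Qed.

Lemma nonresM x y : x != 0 -> y != 0 -> nonres (x * y) = nonres x (+) nonres y.
Proof.
move=> x0 y0; have := euler_criterion (mulf_neq0 x0 y0).
rewrite exprMn !euler_criterion // -signr_addb => e.
have sgnI (a b : bool) : (-1) ^+ a = (-1) ^+ b :> F -> a = b.
  have N1 : (-1 == 1 :> F) = false.
    by rewrite eq_sym -subr_eq0 opprK (negPf two_neq0).
  by case: a b => [] [] //= /eqP; rewrite expr1 expr0 ?(eq_sym 1) N1.
exact/esym/sgnI.
Qed.

Lemma quad_charM x y : quad_char (x * y) = quad_char x * quad_char y.
Proof.
rewrite /quad_char mulf_eq0.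
have [|x0] /= := eqVneq x 0; first by rewrite mul0r.
have [|y0] /= := eqVneq y 0; first by rewrite mulr0.
by rewrite nonresM // signr_addb.
Qed.

Lemma quad_char_sqr x : x != 0 -> quad_char x * quad_char x = 1.
Proof. by move=> x0; rewrite /quad_char (negPf x0); case: nonres. Qed.

Lemma quad_char_nonres x : (nonres x)%:Z *+ 2 = 1 - (x == 0)%:Z - quad_char x.
Proof.
rewrite /quad_char; case: eqP => [->|_]; first by rewrite nonres0.
by case: nonres.
Qed.

Lemma quad_charN1 : quad_char (- 1) = (-1) ^+ #|F|./2.
Proof.
have N10 : (-1 : F) != 0 by rewrite oppr_eq0 oner_eq0.
rewrite /quad_char (negPf N10) /nonres N10 /=.
rewrite -[(-1 : F) ^+ _]signr_odd -[RHS]signr_odd.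
case: odd => /=; last by rewrite expr0 eqxx.
by rewrite expr1 eq_sym -subr_eq0 opprK two_neq0.
Qed.

Section Sums.
Variable z : F.
Hypothesis zN : nonres z.

(** Multiplication by the nonresidue [z] permutes the field and negates the character. *)
Lemma sum_quad_char : \sum_x quad_char x = 0.
Proof.
have z0 : z != 0 by case/andP: zN.
have : \sum_x quad_char x = - \sum_x quad_char x.
  rewrite {1}(reindex_inj (mulfI z0)) /= -sumrN.
  apply: eq_bigr => x _; rewrite quad_charM {1}/quad_char (negPf z0) zN.
  by rewrite expr1 mulN1r.
lia.
Qed.

Lemma sum_delta (u : F) (f : F -> int) : \sum_x (x == u)%:Z * f x = f u.
Proof.
rewrite (bigD1 u) //= eqxx mul1r big1 ?addr0 // => x /negPf ->.
by rewrite mul0r.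
Qed.

Lemma sum_nonres : \sum_x (nonres x)%:Z *+ 2 = #|F|%:Z - 1.
Proof.
under eq_bigr do rewrite quad_char_nonres.
rewrite !sumrB sum_quad_char subr0 big_const iter_addr_0 natz.
congr (_ - _).
by rewrite -[RHS](sum_delta 0 (fun=> 1)); apply: eq_bigr => x _; rewrite mulr1.
Qed.

(** For x nonzero, u - x = x (u / x - 1), so the two factors at x cancel. As x varies, u / x - 1
    takes every value but -1. *)
Lemma jacobsthal_sum u : u != 0 ->
  \sum_x quad_char x * quad_char (u - x) = - quad_char (- 1).
Proof.
move=> u0; rewrite (bigD1 0) //= {1}/quad_char eqxx mul0r add0r.
have -> : - quad_char (-1) = \sum_(x | x != -1) quad_char x.
  have := sum_quad_char; rewrite (bigD1 (-1)) //= => /eqP.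
  by rewrite addrC addr_eq0 => /eqP ->.
rewrite [RHS](reindex (fun x => u / x - 1)) /=; last first.
  exists (fun y => u / (y + 1)) => [x|y].
    by rewrite inE => _; rewrite subrK invf_div mulrCA divff ?mulr1.
  by rewrite inE => _; rewrite invf_div mulrCA divff ?mulr1 // addrK.
apply: eq_big => [x|x x0].
  by rewrite -addr_eq0 subrK mulf_eq0 (negPf u0) invr_eq0.
have -> : u - x = x * (u / x - 1) by rewrite mulrBr mulr1 mulrCA divff ?mulr1.
by rewrite quad_charM mulrA quad_char_sqr // mul1r.
Qed.

Lemma sum_quad_char_conv0 :
  \sum_x quad_char x * quad_char (0 - x) = quad_char (- 1) * (#|F|%:Z - 1).
Proof.
rewrite (bigD1 0) //= {1}/quad_char eqxx mul0r add0r.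
under eq_bigr => x x0.
  rewrite sub0r -mulN1r quad_charM mulrCA quad_char_sqr // mulr1.
over.
have : \sum_(x : F) quad_char (-1) = quad_char (-1) * #|F|%:Z.
  by rewrite big_const iter_addr_0 -mulr_natr natz.
by rewrite (bigD1 0) //= mulrBr mulr1 => <-; rewrite addrAC subrr add0r.
Qed.

Definition nonres_conv u : nat :=
  (\sum_x nonres x * nonres (u - x)%R)%N.

(** Twice the indicator is 1 - delta_0 - chi by [quad_char_nonres]. The factor 4 clears both halves,
    and the product is expanded. *)
Lemma nonres_convE u :
  (nonres_conv u)%:Z *+ 4 = #|F|%:Z - 2 + (u == 0)%:Z + quad_char u *+ 2
     + \sum_x quad_char x * quad_char (u - x).
Proof.
rewrite /nonres_conv -natz natr_sum -sumrMnl.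
pose d x : int := (x == 0)%:Z; pose c x : int := (x == u)%:Z.
have -> : \sum_x (nonres x * nonres (u - x))%:R *+ 4 =
    \sum_x (1 - d x - quad_char x) * (1 - d (u - x) - quad_char (u - x)).
  apply: eq_bigr => x _; rewrite -!quad_char_nonres natrM !natz; ring.
have -> : \sum_x (1 - d x - quad_char x) * (1 - d (u - x) - quad_char (u - x)) =
    \sum_x (1 - c x * 1) - \sum_x quad_char (u - x)
    - \sum_x d x * (1 - d (u - x) - quad_char (u - x)) - \sum_x quad_char x
    + \sum_x c x * quad_char x + \sum_x quad_char x * quad_char (u - x).
  rewrite -!sumrB -!big_split /=; apply: eq_bigr => x _.
  rewrite /c /d subr_eq0 (eq_sym u); ring.
rewrite /c /d sumrB !sum_delta sum_quad_char.
have -> : \sum_x quad_char (u - x) = 0.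
  by rewrite -[RHS]sum_quad_char [RHS](reindex_inj (subrI u)).
rewrite big_const iter_addr_0 natz !subr0 mulr2n; ring.
Qed.

(** Centred at u / 2, the summand is an even function of x, so only its value at the centre decides
    the parity. *)
Lemma odd_nonres_conv u : odd (nonres_conv u) = nonres (u / 2%:R).
Proof.
pose h := u / 2%:R; have hh : u = h + h.
  by rewrite -mulr2n -mulr_natr divfK.
rewrite /nonres_conv (reindex_inj (addrI h)) odd_sum_even_fun /=.
  rewrite addr0 [in u - h]hh addrK; by case: nonres.
by move=> x; rewrite mulnC hh; congr ((nonres _) * (nonres _))%N; ring.
Qed.

Hypothesis card16 : (#|F| %% 16 = 1 \/ #|F| %% 16 = 15)%N.

Lemma quad_charN1_mod16 :
  quad_char (- 1) = if (#|F| %% 16 == 1)%N then 1 else -1.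
Proof.
rewrite quad_charN1 -signr_odd; have := half_card.
set h := #|F|./2 => hE; case: eqP => c16.
  by have -> : odd h = false by lia.
by have -> : odd h = true by lia.
Qed.

(** Four times the count is linear in q = #|F|, so q modulo 16 determines the count modulo 4. *)
Lemma nonres_conv_mod4 u : (4 %| nonres_conv u + nonres u)%N.
Proof.
have := nonres_convE u; have [->|u0] := eqVneq u 0.
  rewrite sum_quad_char_conv0 quad_charN1_mod16 nonres0 {1}/quad_char eqxx.
  by case: eqP; lia.
rewrite jacobsthal_sum // quad_charN1_mod16 /quad_char (negPf u0).
move: (nonres_conv u) (#|F|) card16 => n f f16.
by case: (nonres u); case: eqP; rewrite /= addr0 mulr2n; lia.
Qed.

(** The parity of the count at 2u is [nonres u] by the fixed point, and [nonres (2u)] by the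
    congruence modulo 4. *)
Lemma nonres_double u : nonres (2%:R * u) = nonres u.
Proof.
have := odd_nonres_conv (2%:R * u); rewrite mulrC mulfK // => <-.
have := nonres_conv_mod4 (u * 2%:R); move: (nonres_conv _) => n.
case: (nonres (u * 2%:R)) => /= n4; last by apply/esym/negbTE; lia.
lia.
Qed.
End Sums.
End Nonresidues.

(** * Recurrences as monic polynomials in the shift *)

Lemma recurrenceP (s : nat -> 'Z_4) (L : nat) :
  has_recurrence s L <->
  exists2 f : nat -> 'Z_4, f L = 1 &
    forall u, \sum_(j < L.+1) f j * s (u + j)%N = 0.
Proof.
split=> [[c cP]|[f fL fP]].
  exists (fun j => if j == L then 1 else c (L - j)%N); rewrite ?eqxx // => u.
  rewrite big_ord_recr /= eqxx mul1r addrC -[RHS](cP u); congr (_ + _).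
  rewrite big_add1 /= big_mkord (reindex_inj rev_ord_inj) /=.
  apply: eq_bigr => j _; rewrite ifF.
    by congr (c _ * s _); have := ltn_ord j; lia.
  by apply/negbTE; have := ltn_ord j; lia.
exists (fun j => f (L - j)%N) => u.
rewrite -[RHS](fP u) big_ord_recr /= fL mul1r addrC; congr (_ + _).
rewrite big_add1 /= big_mkord (reindex_inj rev_ord_inj) /=.
by apply: eq_bigr => j _; congr (f _ * s _); have := ltn_ord j; lia.
Qed.

Lemma has_recurrence_leq (s : nat -> 'Z_4) (L M : nat) :
  (L <= M)%N -> has_recurrence s L -> has_recurrence s M.
Proof.
move=> LM /recurrenceP [f fL fP]; apply/recurrenceP.
(* The polynomial is multiplied by E^(M - L). *)
exists (fun j => if (j < M - L)%N then 0 else f (j - (M - L))%N) => [|u].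
  by rewrite ifF ?subKn //; lia.
rewrite -[RHS](fP (u + (M - L))%N).
rewrite -(big_mkord xpredT (fun j => (if (j < M - L)%N then 0 else
  f (j - (M - L))%N) * s (u + j)%N)).
rewrite -(big_mkord xpredT (fun j => f j * s (u + (M - L) + j)%N)).
rewrite (@big_cat_nat _ _ _ (M - L)) /=; [|lia..].
rewrite big_nat big1 ?add0r => [|j /andP[_ ->]]; last by rewrite mul0r.
rewrite -{1}[(M - L)%N]add0n big_addn.
have -> : (M.+1 - (M - L) = L.+1)%N by lia.
apply: eq_bigr => j _.
by rewrite ifF ?addnK; [congr (_ * s _); lia | lia].
Qed.

Lemma char_Z4 : 4%:R = 0 :> 'Z_4.
Proof. exact/val_inj. Qed.

(** * Linear complexity of the model sequence *)

Section Sequence.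
Variable p : nat.
Hypotheses (p_prime : prime p) (p_odd : odd p).

Definition even_ind (u : nat) : 'Z_4 := (~~ odd u)%:R.
Definition zero_ind (u : nat) : 'Z_4 := (u%:R == 0 :> 'F_p)%:R.
Definition nonres_ind (u : nat) : 'Z_4 := (nonres (u%:R : 'F_p))%:R.
Definition crt_seq (u : nat) : 'Z_4 :=
  2%:R * even_ind u + 2%:R * zero_ind u + nonres_ind u.

Lemma natr_p0 : p%:R = 0 :> 'F_p.
Proof. exact: pchar_Fp_0. Qed.

Lemma natr_Fp_eq (m n : nat) : (m%:R == n%:R :> 'F_p) = (m == n %[mod p]).
Proof. by rewrite -val_eqE /= !val_Fp_nat. Qed.

Lemma natr_Fp_eq0 (m : nat) : (m%:R == 0 :> 'F_p) = (p %| m)%N.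
Proof. by rewrite -[0]/(0%:R) natr_Fp_eq mod0n. Qed.

Lemma two_neq0_Fp : (2%:R : 'F_p) != 0.
Proof.
by rewrite natr_Fp_eq0 dvdn_prime2 //; apply: contraTneq p_odd => ->.
Qed.

Lemma sum_ord_Fp (R : nmodType) (f : 'F_p -> R) (u : nat) :
  \sum_(j < p) f (u + j)%:R = \sum_x f x.
Proof.
rewrite [RHS](reindex (fun j : 'I_p => (u + j)%:R)) //.
apply/onW_bij/inj_card_bij; last by rewrite card_Fp // card_ord.
move=> i j /eqP; rewrite natr_Fp_eq eqn_modDl !modn_small // => /eqP.
exact: val_inj.
Qed.

(* [p.+1 * val (- b)] is an even representative of [- b], so the shift does not
   change the parity of [u]. *)
Definition conv_seq (s : nat -> 'Z_4) (u : nat) : 'Z_4 :=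
  \sum_(b : 'F_p | nonres b) s (u + p.+1 * val (- b))%N - s u.

Lemma conv_seq_recurrence (s : nat -> 'Z_4) (L : nat) (f : nat -> 'Z_4) :
  (forall u, \sum_(j < L) f j * s (u + j)%N = 0) ->
  forall u, \sum_(j < L) f j * conv_seq s (u + j)%N = 0.
Proof.
move=> fP u; under eq_bigr do rewrite mulrBr mulr_sumr.
rewrite sumrB fP subr0 exchange_big big1 //= => b _.
by rewrite -[RHS](fP (u + p.+1 * val (- b))%N); under eq_bigr do rewrite addnAC.
Qed.

Lemma even_ind_addp u : even_ind (u + p) = 1 - even_ind u.
Proof.
by rewrite /even_ind oddD p_odd addbT; case: odd; rewrite ?subrr ?subr0.
Qed.

Lemma zero_ind_addp u : zero_ind (u + p) = zero_ind u.
Proof. by rewrite /zero_ind natrD natr_p0 addr0. Qed.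

Lemma nonres_ind_addp u : nonres_ind (u + p) = nonres_ind u.
Proof. by rewrite /nonres_ind natrD natr_p0 addr0. Qed.

Lemma crt_seq_addp u : crt_seq (u + p) = crt_seq u + 2%:R.
Proof.
rewrite /crt_seq even_ind_addp zero_ind_addp nonres_ind_addp.
apply/eqP; rewrite -subr_eq0; apply/eqP.
transitivity (4%:R * - even_ind u); last by rewrite char_Z4 mul0r.
ring.
Qed.

Lemma sum_delta_ord (g : nat -> 'Z_4) (n k : nat) : (k < n)%N ->
  \sum_(j < n) (j == k :> nat)%:R * g j = g k.
Proof.
move=> kn; rewrite (bigD1 (Ordinal kn)) //= eqxx mul1r big1 ?addr0 // => j.
by rewrite -val_eqE /= => /negPf ->; rewrite mul0r.
Qed.

Lemma half_p15 : (p %% 16 = 15)%N -> p./2%:R = 3%:R :> 'Z_4.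
Proof.
by move=> p15; rewrite -[LHS](@Zp_nat_mod 4) // (_ : _ %% _ = 3)%N //; lia.
Qed.

Lemma half_p1 : (p %% 16 = 1)%N -> p./2%:R = 0 :> 'Z_4.
Proof.
by move=> p1; rewrite -[LHS](@Zp_nat_mod 4) // (_ : _ %% _ = 0)%N //; lia.
Qed.

Lemma crt_seq_recurrence_pS : has_recurrence crt_seq p.+1.
Proof.
have p0 := prime_gt1 p_prime.
apply/recurrenceP.
(* Coefficients of (E^p - 1) (E - 1). The first factor turns the sequence into the constant 2. *)
exists (fun j => (j == p.+1)%:R - (j == p)%:R - (j == 1)%:R + (j == 0)%:R).
  by rewrite eqxx (gtn_eqF (ltnSn p)) eqSS (gtn_eqF (ltnW p0)) !subr0 addr0.
move=> u; under eq_bigr do rewrite mulrDl !mulrBl.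
rewrite big_split !sumrB /=.
rewrite !(sum_delta_ord (fun j => crt_seq (u + j)%N)) //; [|lia..].
by rewrite addn0 addn1 addnS -addSn !crt_seq_addp; ring.
Qed.

Lemma card_Fp16 : (p %% 16 = 1 \/ p %% 16 = 15)%N ->
  (#|'F_p| %% 16 = 1 \/ #|'F_p| %% 16 = 15)%N.
Proof. by rewrite card_Fp. Qed.

Variable z : 'F_p.
Hypothesis zN : nonres z.

Lemma card_nonres : #|[pred x : 'F_p | nonres x]| = p./2.
Proof.
have := sum_nonres two_neq0_Fp zN; rewrite card_Fp // sumrMnl.
have -> : \sum_(x : 'F_p) (nonres x)%:Z = #|[pred x : 'F_p | nonres x]|%:Z.
  rewrite -sum1_card -natz natr_sum big_mkcond [RHS]big_mkcond /=.
  by apply: eq_bigr => x _; rewrite inE; case: nonres.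
move: #|_| => n; lia.
Qed.

(** The even shifts fix e, so 2e is multiplied by the number of nonresidues; 2d becomes 2n and n
    becomes -n. Subtracting the sequence cancels n and leaves -2d = 2d. *)
Lemma conv_crt_seq u : (p %% 16 = 1 \/ p %% 16 = 15)%N ->
  conv_seq crt_seq u = 2%:R * (p./2%:R - 1) * even_ind u + 2%:R * zero_ind u.
Proof.
move=> p16.
have uE (b : 'F_p) : (u + p.+1 * val (- b))%:R = u%:R - b :> 'F_p.
  by rewrite natrD natrM -natr1 natr_p0 add0r mul1r natr_Zp.
rewrite /conv_seq.
under eq_bigr => b _.
  rewrite /crt_seq /zero_ind /nonres_ind uE.
  rewrite /even_ind oddD oddM /= p_odd addbF.
over.
rewrite !big_split /= sumr_const card_nonres.
have -> : \sum_(b : 'F_p | nonres b) (nonres (u%:R - b))%:R = - nonres_ind u.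
  apply/eqP; rewrite -addr_eq0 big_mkcond /= /nonres_ind.
  under eq_bigr => b _.
    rewrite (_ : (if _ then _ else _) = (nonres b * nonres (u%:R - b)%R)%:R).
  over.
    by case: nonres; rewrite ?mul1n.
  rewrite -natr_sum -natrD.
  have /dvdnP[k ->] := nonres_conv_mod4 two_neq0_Fp zN (card_Fp16 p16) u%:R.
  by rewrite natrM char_Z4 mulr0.
have -> : \sum_(b : 'F_p | nonres b) 2%:R * (u%:R - b == 0)%:R =
    2%:R * nonres_ind u.
  rewrite -mulr_sumr big_mkcond (bigD1 u%:R) //= subrr eqxx.
  rewrite big1 ?addr0 /nonres_ind.
    by case: nonres.
  by move=> b /negPf bu; rewrite subr_eq0 eq_sym bu; case: nonres.
rewrite -[X in X + _ + _]mulr_natr; apply/eqP; rewrite -subr_eq0; apply/eqP.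
transitivity (4%:R * - zero_ind u); last by rewrite char_Z4 mul0r.
by rewrite /crt_seq /even_ind; ring.
Qed.

Lemma sum_nonres_ind u : \sum_(j < p) nonres_ind (u + j) = p./2%:R.
Proof.
rewrite (sum_ord_Fp (fun x => (nonres x)%:R)) -card_nonres -sum1_card natr_sum.
rewrite [RHS]big_mkcond /=.
by apply: eq_bigr => x _; rewrite inE; case: nonres.
Qed.

Lemma crt_seq_recurrence_p : (p %% 16 = 15)%N -> has_recurrence crt_seq p.
Proof.
move=> p15; apply/recurrenceP.
(* This is E^p - 1 + 2 (E^(p-1) + ... + 1). The first part gives 2, the second 2 * 3 = 2, and 2 + 2
   = 0. *)
exists (fun j => (j == p)%:R - (j == 0)%:R + 2%:R * (j < p)%:R) => [|u].
  by rewrite eqxx ltnn mulr0 addr0 (gtn_eqF (prime_gt0 p_prime)) subr0.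
under eq_bigr do rewrite mulrDl mulrBl.
rewrite big_split sumrB /=.
rewrite (sum_delta_ord (fun j => crt_seq (u + j)%N)) //.
rewrite (sum_delta_ord (fun j => crt_seq (u + j)%N)) //.
rewrite addn0 crt_seq_addp (addrC (crt_seq u)) addrK.
rewrite big_ord_recr /= ltnn mulr0 mul0r addr0.
have -> : \sum_(j < p) 2%:R * (j < p)%:R * crt_seq (u + j) =
    2%:R * \sum_(j < p) nonres_ind (u + j).
  rewrite mulr_sumr; apply: eq_bigr => j _; rewrite ltn_ord mulr1 /crt_seq.
  by rewrite mulrDr mulrDr !mulrA -natrM char_Z4 !mul0r !add0r.
rewrite sum_nonres_ind half_p15 //; exact/val_inj.
Qed.

Lemma two_Z4_neq0 : 2%:R != 0 :> 'Z_4.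
Proof. by []. Qed.

Lemma crt_seq_recurrence_geq_p (L : nat) :
  (p %% 16 = 15)%N -> has_recurrence crt_seq L -> (p <= L)%N.
Proof.
move=> p15 /recurrenceP[f fL /conv_seq_recurrence fP]; rewrite leqNgt.
(* At u = p - L the leading term sits at p, and all others strictly between 0 and p, where d
   vanishes. *)
apply/negP => Lp; have := fP (p - L)%N; rewrite big_ord_recr /= fL mul1r.
have vE u : conv_seq crt_seq u = 2%:R * zero_ind u.
  rewrite conv_crt_seq ?half_p15 //; last by right.
  rewrite (_ : 2%:R * (3%:R - 1) = 0 :> 'Z_4) ?mul0r ?add0r //.
  exact/val_inj.
rewrite vE /zero_ind subnK ?(ltnW Lp) // natr_p0 eqxx mulr1 big1 ?add0r.
  by apply/eqP.
move=> j _; rewrite vE /zero_ind natr_Fp_eq0 gtnNdvd ?mulr0 //.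
  lia.
by have := ltn_ord j; lia.
Qed.

Lemma crt_seq_recurrence_gt_p (L : nat) :
  (p %% 16 = 1)%N -> has_recurrence crt_seq L -> (p < L)%N.
Proof.
move=> p1 rec; rewrite ltnNge; apply/negP => Lp.
have /recurrenceP[f fp /conv_seq_recurrence fP] := has_recurrence_leq Lp rec.
have p0 := prime_gt0 p_prime.
have two_opp (x : 'Z_4) : - (2%:R * x) = 2%:R * x.
  by apply/eqP; rewrite eq_sym -addr_eq0 -mulrDl -natrD char_Z4 mul0r.
have vE u : conv_seq crt_seq u = 2%:R * even_ind u + 2%:R * zero_ind u.
  rewrite conv_crt_seq; last by left.
  by rewrite half_p1 // add0r mulrN1 mulNr two_opp.
pose G u := \sum_(j < p.+1) f j * (2%:R * zero_ind (u + j)).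
(* f(E) kills 2e + 2d, and signs do not matter on multiples of 2. *)
have GE u : G u = 2%:R * \sum_(j < p.+1) f j * even_ind (u + j).
  rewrite -two_opp; apply/eqP; rewrite -addr_eq0 -[X in _ == X](fP u) addrC.
  rewrite /G mulr_sumr -big_split /=; apply/eqP/eq_bigr => j _.
  by rewrite vE; ring.
have G2 u : G u.+2 = G u.
  rewrite !GE; congr (_ * _); apply: eq_bigr => j _.
  by rewrite /even_ind !addSn /= negbK.
have Gp u : G (u + p)%N = G u.
  by rewrite /G; apply: eq_bigr => j _; rewrite addnAC zero_ind_addp.
have GS u : G u.+1 = G u.
  have Gdouble k : G (u + k.*2)%N = G u.
    elim: k => [|k IHk]; first by rewrite addn0.
    by rewrite doubleS !addnS G2.
  (* p + 1 is even, so steps of 2 lead from u to u + 1 + p. *)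
  rewrite -Gp -(Gdouble p./2.+1); congr G; lia.
have Gconst u : G u = G 0 by elim: u => // u <-.
(* Among the indices 0, ..., p only i = j makes p - j + i a multiple of p; for j = 0 or j = p both
   ends would contribute. *)
have fE j : (0 < j < p)%N -> 2%:R * f j = G 0.
  move=> /andP[j0 jp]; rewrite -(Gconst (p - j)%N) /G.
  have jp' : (j < p.+1)%N by lia.
  rewrite (bigD1 (Ordinal jp')) //= subnK; last by lia.
  rewrite /zero_ind natr_p0 eqxx mulr1 mulrC big1 ?addr0 // => i ij.
  rewrite natr_Fp_eq0 (_ : (p %| p - j + i)%N = false) ?mulr0 //.
  apply: contraNF ij => /dvdnP[k ki]; rewrite -val_eqE /=.
  by have := ltn_ord i; case: k ki => [|[|k]]; rewrite ?mulSn; lia.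
have sum_even n : \sum_(j < n) even_ind j = (uphalf n)%:R.
  elim: n => [|n IHn]; first by rewrite big_ord0.
  rewrite big_ord_recr /= IHn /even_ind -natrD; congr _%:R.
  by rewrite uphalf_half; case: odd; lia.
have := fP 0; rewrite big_ord_recr /= vE fp mul1r add0n /zero_ind natr_p0 eqxx.
rewrite /even_ind p_odd mulr0 mulr1 add0r.
suff -> : \sum_(j < p) f j * conv_seq crt_seq (0 + j) = 0.
  by rewrite add0r => /eqP; rewrite (negPf two_Z4_neq0).
(* The term j = 0 vanishes since 2e + 2d = 4 there, whence the -1. There remain [p./2] even indices,
   a multiple of 4. *)
transitivity (G 0 * (\sum_(j < p) even_ind j - 1)); last first.
  rewrite sum_even uphalf_half p_odd natrD half_p1 // addr0 subrr.
  by rewrite mulr0.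
pose i0 : 'I_p := Ordinal (prime_gt0 p_prime).
rewrite (bigD1 i0) //= [in RHS](bigD1 i0) //= [1 + _]addrC addrK vE add0n.
rewrite {1}/zero_ind {1}/even_ind eqxx.
rewrite (_ : 2%:R * _ + 2%:R * _ = 0); last exact/val_inj.
rewrite mulr0 add0r mulr_sumr.
apply: eq_bigr => j; rewrite -val_eqE /= -lt0n => j0.
rewrite add0n vE /zero_ind natr_Fp_eq0 gtnNdvd // mulr0 addr0.
by rewrite mulrCA mulrA fE // j0 ltn_ord.
Qed.

End Sequence.

(** * The classes D and E in terms of parity and residuosity *)

Section Classes.
Variables (p : nat) (g : int).
Hypotheses (p_prime : prime p) (p_odd : odd p).
Hypothesis g_prim : primitive_root_mod p g.

Let two_neq0 := two_neq0_Fp p_prime p_odd.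
Let half_cardp : (#|'F_p|./2 = p./2)%N. Proof. by rewrite card_Fp. Qed.

(** ['F_p] is ['Z_(pdiv p)], hence the passage through [pdiv_id]. *)
Lemma prim_root_Fp : p.-1.-primitive_root (g%:~R : 'F_p).
Proof.
have : primitive_root_mod (pdiv p) g by rewrite pdiv_id.
by rewrite /primitive_root_mod (congr1 totient (pdiv_id p_prime)) totient_prime.
Qed.

Lemma generator_neq0 : (g%:~R : 'F_p) != 0.
Proof.
have /eqP := prim_expr_order prim_root_Fp; have p1 := prime_gt1 p_prime.
apply: contraTneq => ->; rewrite expr0n (_ : (p.-1 == 0) = false); last by lia.
by rewrite eq_sym oner_eq0.
Qed.

Lemma generator_nonres (k : nat) : nonres ((g%:~R : 'F_p) ^+ k) = odd k.
Proof.
have gp := prim_root_Fp; have p1 := prime_gt1 p_prime.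
have g0 := generator_neq0.
have g1 : nonres (g%:~R : 'F_p).
  rewrite /nonres g0 half_cardp -(prim_order_dvd gp) gtnNdvd //; lia.
elim: k => [|k IHk]; first by rewrite /nonres expr0 expr1n eqxx andbF.
by rewrite exprS nonresM ?expf_neq0 // g1 IHk.
Qed.

Lemma generator_powers (i : bool) (x : 'F_p) :
  reflect (exists n : 'I_((p - 3) %/ 2).+1, x = g%:~R ^+ (2 * n + i))
          ((x != 0) && (nonres x == i)).
Proof.
have gp := prim_root_Fp; have p1 := prime_gt1 p_prime.
have g0 := generator_neq0.
apply: (iffP andP) => [[x0 /eqP xi]|[n ->]]; last first.
  rewrite expf_neq0 // generator_nonres; split=> //.
  by rewrite oddD oddM /=; case: (i).
have xp : x ^+ p.-1 = 1.
  apply: (mulfI x0); rewrite mulr1 -exprS prednK ?prime_gt0 //.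
  by have := expf_card x; rewrite card_Fp.
have [k xk] := prim_rootP gp xp.
have ki : odd k = i by rewrite -generator_nonres -xk.
(* The discrete logarithm k is below p - 1, so its half is at most (p - 3) / 2. *)
have kp := ltn_ord k.
have k2 : (k./2 < ((p - 3) %/ 2).+1)%N by lia.
exists (Ordinal k2); rewrite xk /=; congr (_ ^+ _); rewrite -ki; lia.
Qed.

Lemma natr_Z2p_eq (m n : nat) : (m%:R == n%:R :> 'Z_(2 * p)) =
  (odd m == odd n) && (m%:R == n%:R :> 'F_p).
Proof.
have p1 := prime_gt1 p_prime.
have p2 : (1 < 2 * p)%N by lia.
rewrite -val_eqE /= !(val_Zp_nat p2) natr_Fp_eq //.
rewrite chinese_remainder ?coprime2n // !modn2; congr (_ && _).
by case: odd; case: odd.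
Qed.

Hypothesis g_odd : ~~ (2 %| g)%Z.

(** A natural representative of [g], which has a parity and maps to both rings. *)
Let m : nat := `|(g %% (2 * p)%N)%Z|%N.

Let gE : g = (g %/ (2 * p)%N)%Z * (2 * p)%N + m.
Proof.
rewrite [LHS](divz_eq g (2 * p)%N) gez0_abs //; apply: modz_ge0.
by have := prime_gt0 p_prime; lia.
Qed.

Let g_Z2p : g%:~R = m%:R :> 'Z_(2 * p).
Proof.
have p1 := prime_gt1 p_prime.
rewrite [in LHS]gE rmorphD rmorphM /= -!pmulrn.
rewrite (_ : (2 * p)%:R = 0 :> 'Z_(2 * p)) ?mulr0 ?add0r //.
by apply/val_inj; rewrite /= val_Zp_nat ?modnn //; lia.
Qed.

Let g_Fp : g%:~R = m%:R :> 'F_p.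
Proof.
rewrite [in LHS]gE rmorphD rmorphM /= -!pmulrn.
by rewrite natrM natr_p0 // !mulr0 add0r.
Qed.

Let m_odd : odd m.
Proof. by have := gE; move: (g %/ _)%Z => q; lia. Qed.

Lemma mem_classD (i : bool) (u : nat) : (u%:R \in classD p g i) =
  [&& odd u, u%:R != 0 :> 'F_p & nonres (u%:R : 'F_p) == i].
Proof.
apply/imsetP/andP => [[n _ /eqP]|[u_odd /generator_powers[n un]]].
  rewrite g_Z2p -natrX natr_Z2p_eq oddX m_odd orbT natrX -g_Fp.
  move=> /andP[/eqP -> /eqP ->]; split=> //.
  by apply/generator_powers; exists n.
exists n => //; apply/eqP.
by rewrite g_Z2p -natrX natr_Z2p_eq oddX m_odd orbT u_odd natrX -g_Fp un !eqxx.
Qed.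

Hypothesis p16 : (p %% 16 = 1 \/ p %% 16 = 15)%N.

Lemma mem_classE (i : bool) (u : nat) : (u%:R \in classE p g i) =
  [&& ~~ odd u, u%:R != 0 :> 'F_p & nonres (u%:R : 'F_p) == i].
Proof.
have zN : nonres (g%:~R : 'F_p) by rewrite -[g%:~R]expr1 generator_nonres.
have nres2 := nonres_double two_neq0 zN (card_Fp16 p_prime p16).
apply/imsetP/andP => [[v + /eqP]|[u_even /andP[u0 uN]]].
  rewrite -(natr_Zp v) -natrM mem_classD natr_Z2p_eq oddM /=.
  move=> /and3P[v_odd v0 vN] /andP[/eqP -> /eqP ->]; split=> //.
  by rewrite natrM nres2 // mulf_neq0.
have : (u%:R / 2%:R != 0 :> 'F_p) && (nonres (u%:R / 2%:R : 'F_p) == i).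
  rewrite mulf_neq0 ?invr_eq0 //= -nres2 mulrCA divff // mulr1.
  exact: uN.
case/generator_powers => n un.
(* An odd integer congruent to u / 2 modulo p; its double agrees with u modulo 2 and modulo p. *)
exists (m ^ (2 * n + i))%:R.
  rewrite mem_classD oddX m_odd orbT /= natrX -g_Fp.
  by apply/generator_powers; exists n.
apply/eqP; rewrite -natrM natr_Z2p_eq oddM /= (negPf u_even) eqxx /=.
by rewrite natrM natrX -g_Fp -un mulrCA divff // mulr1.
Qed.

(** At multiples of p, 2e + 2d is 0 or 2 according to parity. Elsewhere D is the odd part with value
    n, and E the even part with value 2 + n. *)
Lemma quaternary_seqE (u : nat) : quaternary_seq p g u = crt_seq p u.
Proof.
rewrite /quaternary_seq (mem_classD false) (mem_classD true).
rewrite (mem_classE false) (mem_classE true).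
rewrite -[(0 : 'Z_(2 * p))]/(0%:R) !natr_Z2p_eq p_odd natr_p0 // /=.
rewrite /crt_seq /even_ind /zero_ind /nonres_ind.
have [->|u0] := eqVneq (u%:R : 'F_p) 0.
  by rewrite nonres0; case: odd; apply/val_inj.
by case: nonres; case: odd; apply/val_inj.
Qed.
End Classes.

(** * Transfer to the quaternary sequence *)

Lemma has_recurrence_ext (s t : nat -> 'Z_4) (L : nat) :
  s =1 t -> has_recurrence s L -> has_recurrence t L.
Proof.
move=> st [c cP]; exists c => u; rewrite -[RHS](cP u) !st; congr (_ + _).
by apply: eq_bigr => j _; rewrite st.
Qed.

Theorem theorem13 (p : nat) (g : int)
  (p_prime : prime p) (p_odd : odd p)
  (g_odd : ~~ (2 %| g)%Z)
  (g_prim_p : primitive_root_mod p g)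
  (g_prim_2p : primitive_root_mod (2 * p) g) :
  ((p%:Z = -1 %[mod 16])%Z ->
     is_linear_complexity (quaternary_seq p g) p) /\
  ((p%:Z = 1 %[mod 16])%Z ->
     is_linear_complexity (quaternary_seq p g) (p + 1)).
Proof.
have zN : nonres (g%:~R : 'F_p) by rewrite -[g%:~R]expr1 generator_nonres.
split=> p16.
  have p15 : (p %% 16 = 15)%N by lia.
  have sE := quaternary_seqE p_prime p_odd g_prim_p g_odd (or_intror p15).
  have tE : crt_seq p =1 quaternary_seq p g by move=> u; rewrite sE.
  split=> [|L /(has_recurrence_ext sE)].
    by apply/(has_recurrence_ext tE)/(crt_seq_recurrence_p _ _ zN).
  exact: (crt_seq_recurrence_geq_p _ _ zN).
have p1 : (p %% 16 = 1)%N by lia.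
have sE := quaternary_seqE p_prime p_odd g_prim_p g_odd (or_introl p1).
have tE : crt_seq p =1 quaternary_seq p g by move=> u; rewrite sE.
split=> [|L /(has_recurrence_ext sE)]; rewrite addn1.
  by apply/(has_recurrence_ext tE)/crt_seq_recurrence_pS.
exact: (crt_seq_recurrence_gt_p _ _ zN).
Qed.
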